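(* Let $V,W\subset X$ be subspaces. Given bases $(v_1,\dots,v_p)$ of $V$ and $(w_1,\dots,w_q)$ of $W$, let $A=(\langle w_i,w_j\rangle)$ (a $q\times q$ matrix), $B=(\langle w_i,v_j\rangle)$ (a $q\times p$ matrix) and $D=(\langle v_i,v_j\rangle)$ (a $p\times p$ matrix). Then $$\cos^2\Theta_{V,W}=\frac{\det(\bar{B}^TA^{-1}B)}{\det D}.$$ If $p=q$ this reduces to $$\cos^2\Theta_{V,W}=\frac{|\det B|^2}{\det A\cdot\det D}.$$
   Context: $X$ is an $n$-dimensional vector space over $\mathbb{R}$ (real case) or $\mathbb{C}$ (complex case) with an inner product $\langle\cdot,\cdot\rangle$ (Hermitian in the complex case, conjugate-linear in the left entry). Subspaces and dimensions are over the same field. $\bar B^T$ is the conjugate transpose of $B$. Principal angles: for nonzero subspaces $V,W\subset X$, with $p=\dim V$, $q=\dim W$, $m=\min\{p,q\}$, there are orthonormal bases $(e_1,\dots,e_p)$ of $V$ and $(f_1,\dots,f_q)$ of $W$ and uniquely determined numbers $0\le\theta_1\le\dots\le\theta_m\le\frac{\pi}{2}$ (the principal angles) such that $\langle e_i,f_j\rangle=\delta_{ij}\cos\theta_i$ (equal to $0$ whenever $i\neq j$). Grassmann angle: for nonzero subspaces $V,W\subset X$ with principal angles $\theta_1,\dots,\theta_m$, the Grassmann angle $\Theta_{V,W}\in[0,\frac{\pi}{2}]$ of $V$ with $W$ is $\Theta_{V,W}=\arccos(\cos\theta_1\cdots\cos\theta_m)$ if $\dim V\le\dim W$, and $\Theta_{V,W}=\frac{\pi}{2}$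 if $\dim V>\dim W$. Also $\Theta_{\{0\},\{0\}}=\Theta_{\{0\},V}=0$ and $\Theta_{V,\{0\}}=\frac{\pi}{2}$ for $V\ne\{0\}$. *)

(* Defs.v *)
From HB Require Import structures.
From mathcomp Require Import all_boot all_order all_algebra.
From mathcomp Require Import complex.
From mathcomp Require Import boolp classical_sets reals trigo.

Set Implicit Arguments.
Unset Strict Implicit.
Unset Printing Implicit Defensive.

Import Order.TTheory GRing.Theory Num.Theory.

Local Open Scope ring_scope.

(* The scalar field is K, with conjugation conj, and iota embeds the reals in
   K: (K, conj, iota) is (R, idfun, idfun) in the real case and
   (R[i], Num.conj, real_complex R) in the complex case. *)
Section GrassmannAngle.
Variables (R : realType) (K : numFieldType).
Variables (conj : {rmorphism K -> K}) (iota : R -> K).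
Variables (X : vectType K) (form : {dot X for conj}).

(* A form in {dot X for conj} is linear on the left and conjugate-linear on
   the right; swapping its arguments makes the inner product conjugate-linear
   on the left. *)
Definition inner (x y : X) : K := form y x.

Definition gram (p q : nat) (x : p.-tuple X) (y : q.-tuple X) : 'M[K]_(p, q) :=
  \matrix_(i < p, j < q) inner (tnth x i) (tnth y j).

Definition is_principal_angles (V W : {vspace X}) (theta : seq R) : Prop :=
  [/\ size theta = minn (\dim V) (\dim W),
      sorted <=%R theta,
      {in theta, forall t, 0 <= t <= pi / 2} &
      exists (e : (\dim V).-tuple X) (f : (\dim W).-tuple X),
        [/\ basis_of V e /\ orthonormal form e,
            basis_of W f /\ orthonormal form f &
            forall (i : 'I_(\dim V)) (j : 'I_(\dim W)),
              inner (tnth e i) (tnth f j) =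
              if i == j :> nat then iota (cos theta`_i) else 0]].

(* The default value [::] is irrelevant: in the real and complex cases,
   nonzero V and W have exactly one list of principal angles. *)
Definition principal_angles (V W : {vspace X}) : seq R :=
  xget [::] [set theta | is_principal_angles V W theta]%classic.

Definition grassmann_angle (V W : {vspace X}) : R :=
  if V == 0%VS then 0
  else if W == 0%VS then pi / 2
  else if (\dim V <= \dim W)%N
  then acos (\prod_(t <- principal_angles V W) cos t)
  else pi / 2.

End GrassmannAngle.

Arguments inner {K conj X} form x y.
Arguments gram {K conj X} form {p q} x y.
Arguments is_principal_angles {R K conj} iota {X} form V W theta.
Arguments principal_angles {R K conj} iota {X} form V W.
Arguments grassmann_angle {R K conj} iota {X} form V W.

(* Main.v *)
Require Import Defs.
From HB Require Import structures.
From mathcomp Require Import all_boot all_order all_algebra.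
From mathcomp Require Import complex.
From mathcomp Require Import classical_sets reals trigo.
From mathcomp Require Import lra.

Set Implicit Arguments.
Unset Strict Implicit.
Unset Printing Implicit Defensive.

Import Order.TTheory GRing.Theory Num.Theory.

Local Open Scope ring_scope.
Local Open Scope complex_scope.

(** The proof has two independent parts: principal angles exist, and, once
orthonormal bases realizing them are chosen, the formula is a change of basis.

Existence. Let P be the orthogonal projection onto W. The form
(x, y) |-> <P x, P y> is Hermitian on V, so it is diagonal in some orthonormal
basis e of V: an eigenvector x of its matrix satisfies
<P x, P y> = a <x, y> for all y in V, hence the orthogonal complement of x in V
is again orthogonal to x for the second form, and one recurses on it
([form_diag_step], [orthobasis_diag]). The vectors P e_i are then orthogonal;
dividing the nonzero ones by their lengths c_i, which are at most 1 since P is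
a contraction, and completing to an orthonormal basis f of W gives
P e_i = c_i f_i, hence <e_i, f_j> = delta_ij c_i. The angles are the arccosines
of the c_i, taken in increasing order ([principal_angles_exist]).

Formula. If v = C e and w = Q f, the Gram matrices factor through C, Q and
their conjugates; in conj(B)^T A^-1 B the matrix Q cancels against A^-1 and
what remains is conj(C) E E^* C^T with E = (<e_i, f_j>), while
D = conj(C) C^T. So the quotient is det (E E^* ), the product of the squared
cosines ([det_gram_ratio], [det_principal_angles]). If dim V > dim W the
determinant vanishes because its matrix factors through a smaller dimension,
and the cosine is that of a right angle.

Everything is done once over a field K with a conjugation and an embedding
iota of the reals. Apart from elementary compatibilities, only the existence of
an eigenvalue for every Hermitian matrix is required of K: over the complex
numbers this is algebraic closedness, and over the reals a complex eigenvalue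
of the complexified symmetric matrix is shown to be real
([symmetric_eigenvalue]). *)

(** * Matrices and arccosines *)

Lemma det_mul_narrow (F : fieldType) (m n : nat)
    (M : 'M[F]_(m, n)) (N : 'M_(n, m)) :
  (n < m)%N -> \det (M *m N) = 0.
Proof.
move=> nm; apply/eqP; apply: contraTT nm => d0; rewrite -leqNgt.
have /eqP <- : row_free (M *m N) by rewrite row_free_unit unitmxE unitfE.
exact: leq_trans (mxrankM_maxl _ _) (rank_leq_col _).
Qed.

Lemma invmx_mul (F : fieldType) (n : nat) (M N : 'M[F]_n) :
  M \in unitmx -> N \in unitmx -> N *m invmx (M *m N) *m M = 1%:M.
Proof.
move=> uM uN; have uMN : M *m N \in unitmx by rewrite unitmx_mul uM.
suff -> : N *m invmx (M *m N) = invmx M by rewrite mulVmx.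
by rewrite -[LHS]mul1mx -(mulVmx uM) -mulmxA (mulmxA M) mulmxV // mulmx1.
Qed.

(** The complexified matrix has an eigenvalue z with eigenvector v; comparing
z <v, v> = v B v^* with its own conjugate transpose shows that z is real, hence
a root of the characteristic polynomial over R. *)
Lemma symmetric_eigenvalue (R : rcfType) (n : nat) (A : 'M[R]_n) :
  (0 < n)%N -> A^T = A -> exists a, eigenvalue A a.
Proof.
move=> n0 symA; pose B := map_mx (real_complex R) A.
have [z zB] := eigenvalue_closed B n0.
have /eigenvalueP[v vB v0] := zB.
have hermB : (B ^t Num.conj)%sesqui = B.
  rewrite map_trmx symA -map_mx_comp; apply: eq_map_mx => r /=.
  exact: conjc_real.
have zreal : z \is Num.real.
  have vv0 : dotmx v v != 0 by rewrite gt_eqF ?dnorm_gt0.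
  pose M := v *m B *m (v ^t Num.conj)%sesqui.
  have zvv : z * dotmx v v = M 0 0 by rewrite /M vB -scalemxAl mxE dotmxE.
  have hermM : (M ^t Num.conj)%sesqui = M.
    by rewrite !trmx_mul !map_mxM trmxCK hermB mulmxA.
  have vvJ : Num.conj (dotmx v v) = dotmx v v.
    exact/CrealP/ger0_real/dnorm_ge0.
  apply/CrealP/(mulIf vv0); rewrite zvv -[X in _ * X]vvJ -rmorphM zvv.
  by rewrite -[in RHS]hermM [in RHS]mxE [in RHS]mxE.
exists (complex.Re z).
rewrite eigenvalue_root_char -(fmorph_root (real_complex R)).
by rewrite map_char_poly -eigenvalue_root_char /= RRe_real.
Qed.

Lemma acos_pihalf_itv (R : realType) (r : R) :
  0 <= r <= 1 -> 0 <= acos r <= pi / 2.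
Proof.
case/andP=> r0 r1.
have rI : -1 <= r <= 1 by rewrite r1 (le_trans _ r0) ?lerN10.
rewrite acos_ge0 //= leNgt; apply/negP => lt.
suff : cos (acos r) < cos (pi / 2).
  by rewrite cos_pihalf acosK ?in_itv //= ltNge r0.
have pi0 := pi_gt0 R.
have rpi : acos r \in `[0, pi] by rewrite in_itv /= acos_ge0 ?acos_lepi.
by rewrite ltr_cos // in_itv /=; lra.
Qed.

(** * Orthonormal families and orthogonal projections *)

Section InnerProductSpace.
Variables (R : realType) (K : numFieldType).
Variables (conj : {rmorphism K -> K}) (iota : {rmorphism R -> K}) (re : K -> R).
Hypothesis conj_iota : forall r, conj (iota r) = iota r.
Hypothesis iota_le : {mono iota : r1 r2 / r1 <= r2}.
Hypothesis reK : forall x, 0 <= x -> iota (re x) = x.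
(* The only spectral input; the induction of orthobasis_diag turns it into
   diagonalizability. *)
Hypothesis hermitian_eigenvalue : forall (n : nat) (A : 'M[K]_n),
  (0 < n)%N -> map_mx conj A^T = A -> exists a, eigenvalue A a.

Variables (X : vectType K) (form : {dot X for conj}).
Implicit Types (x y : X) (s t : seq X) (U V W : {vspace X}).

Lemma formC0 x y : form x y = 0 -> form y x = 0.
Proof. by move/eqP; rewrite herm_eq0C => /eqP. Qed.

Lemma form_conjC x y : conj (form x y) = form y x.
Proof. by rewrite [RHS]hermC expr0 mul1r. Qed.

Lemma form_ge0 x : 0 <= form x x.
Proof.
have [->|x0] := eqVneq x 0; first by rewrite linear0l.
exact/ltW/neq0_dnorm_gt0.
Qed.

Lemma form_eq0 x : (form x x == 0) = (x == 0).
Proof.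
have [->|x0] := eqVneq x 0; first by rewrite linear0l eqxx.
exact/gt_eqF/neq0_dnorm_gt0.
Qed.

Lemma orthonormal_cons x s :
  orthonormal form (x :: s) =
  [&& form x x == 1, all (fun y => form x y == 0) s & orthonormal form s].
Proof.
rewrite /orthonormal /= /ortho_rec /= andbT -andbA; congr (_ && _).
exact: andbCA.
Qed.

(** Orthonormality as a condition on members rather than positions, from which
its invariance under permutations can be read off. *)
Lemma orthonormal_kronP s :
  reflect (uniq s /\ {in s &, forall x y, form x y = (x == y)%:R})
          (orthonormal form s).
Proof.
elim: s => [|x s IHs]; first by left.
rewrite orthonormal_cons.
apply: (iffP and3P) => [[/eqP x1 /allP xs /IHs[us os]]|].
  have xNs : x \notin s.
    by apply/negP => /xs; rewrite x1 oner_eq0.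
  split=> [/=|y z]; first by rewrite xNs us.
  rewrite !inE => /predU1P[->|ys] /predU1P[->|zs]; last exact: os.
  - by rewrite eqxx.
  - by rewrite (eqP (xs _ zs)) [x == z]eq_sym (negPf (memPn xNs _ zs)).
  - by rewrite (formC0 (eqP (xs _ ys))) (negPf (memPn xNs _ ys)).
case=> /= /andP[xNs us] os; split.
- by rewrite os ?mem_head // eqxx.
- apply/allP => y ys; rewrite os ?mem_head ?inE ?ys ?orbT //.
  by rewrite [x == y]eq_sym (negPf (memPn xNs _ ys)).
- apply/IHs; split=> // y z ys zs; apply: os; by rewrite inE ?ys ?zs orbT.
Qed.

Lemma perm_orthonormal s t :
  perm_eq s t -> orthonormal form s = orthonormal form t.
Proof.
move=> st; apply/orthonormal_kronP/orthonormal_kronP => -[u o]; split.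
- by rewrite -(perm_uniq st).
- by move=> x y; rewrite -!(perm_mem st); apply: o.
- by rewrite (perm_uniq st).
- by move=> x y; rewrite !(perm_mem st); apply: o.
Qed.

Lemma orthonormal_nth s i j : orthonormal form s ->
  (i < size s)%N -> (j < size s)%N -> form s`_i s`_j = (i == j)%:R.
Proof.
by move=> /orthonormal_kronP[us os] si sj; rewrite os ?mem_nth // nth_uniq.
Qed.

Definition orthoproj s x : X := \sum_(y <- s) form x y *: y.

Lemma orthoproj_mem s x : orthoproj s x \in <<s>>%VS.
Proof.
rewrite /orthoproj big_seq; apply: rpred_sum => y ys.
exact/rpredZ/memv_span.
Qed.

Fact orthoproj_is_linear s : linear (orthoproj s).
Proof.
move=> a x y; rewrite /orthoproj scaler_sumr -big_split /=.
by apply: eq_bigr => z _; rewrite linearPl scalerDl scalerA.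
Qed.
HB.instance Definition _ s :=
  GRing.isLinear.Build K X X *:%R (orthoproj s) (orthoproj_is_linear s).

Lemma form_orthoprojl s x y : orthonormal form s -> y \in <<s>>%VS ->
  form (orthoproj s x) y = form x y.
Proof.
move=> /orthonormal_kronP[us os].
rewrite -[s in <<s>>%VS]in_tupleE => /coord_span ->.
rewrite !linear_sumr; apply: eq_bigr => i _; rewrite !linearZr_LR /=.
congr (_ * _); set z := s`_i; have zs : z \in s by exact/mem_nth/ltn_ord.
rewrite linear_sumlz (bigD1_seq z) //= big_seq_cond big1 => [|u].
  by rewrite addr0 linearZl_LR /= (os z z) // eqxx mulr1.
by case/andP=> us' uz; rewrite linearZl_LR /= (os u z) // (negPf uz) mulr0.
Qed.

Lemma form_orthoprojr s x y : orthonormal form s -> x \in <<s>>%VS ->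
  form x (orthoproj s y) = form x y.
Proof. by move=> os xs; rewrite -form_conjC form_orthoprojl // form_conjC. Qed.

Lemma orthonormal_free s : orthonormal form s -> free s.
Proof.
move=> os; rewrite -(in_tupleE s); apply/freeP => a a0 i.
have := congr1 (fun x => form x s`_i) a0; rewrite linear0l linear_sumlz.
rewrite (bigD1 i) //= big1 => [|j ji].
  by rewrite addr0 linearZl_LR /= orthonormal_nth // eqxx mulr1.
by rewrite linearZl_LR /= orthonormal_nth // val_eqE (negPf ji) mulr0.
Qed.

Lemma orthonormal_basis_of s W :
  orthonormal form s -> {subset s <= W} -> (\dim W <= size s)%N ->
  basis_of W s.
Proof.
move=> os sW dW; rewrite basisEfree orthonormal_free // dW andbT.
exact/span_subvP.
Qed.

Lemma size_basis_of s W : basis_of W s -> size s = \dim W.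
Proof. by move=> sW; rewrite (size_basis (X := in_tuple s) sW). Qed.

(** The length of [P x] as a real number: [re] is a left inverse of [iota] on
nonnegative scalars. *)
Definition seminorm (P : X -> X) x : R := Num.sqrt (re (form (P x) (P x))).

Lemma iota_ge0 r : (0 <= iota r) = (0 <= r).
Proof. by rewrite -(rmorph0 iota) iota_le. Qed.

Lemma sqr_seminorm P x : iota (seminorm P x) ^+ 2 = form (P x) (P x).
Proof.
have h := reK (form_ge0 (P x)).
by rewrite -rmorphXn /= sqr_sqrtr // -iota_ge0 h form_ge0.
Qed.

Lemma seminorm_eq0 P x : (seminorm P x == 0) = (P x == 0).
Proof. by rewrite -(fmorph_eq0 iota) -sqrf_eq0 sqr_seminorm form_eq0. Qed.

Lemma form_normalize P x : P x != 0 ->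
  let a := (iota (seminorm P x))^-1 in form (a *: P x) (a *: P x) = 1.
Proof.
move=> Px0 a; rewrite linearZl_LR linearZr_LR /= /a fmorphV conj_iota.
rewrite -sqr_seminorm expr2 mulrA -mulrA mulKf ?mulVf //;
  by rewrite fmorph_eq0 seminorm_eq0.
Qed.

(** * Simultaneous diagonalization *)

(** Gram-Schmidt for two forms at once: normalize the vector x provided for V,
then recurse on the complement of x in V, where the hypothesis on x makes
[form (P x) (P _)] vanish as well. *)
Lemma orthobasis_diag (P : {linear X -> X}) V :
  (forall U, (U <= V)%VS -> U != 0%VS -> exists x,
     [/\ x \in U, x != 0 &
         {in U, forall y, form x y = 0 -> form (P x) (P y) = 0}]) ->
  exists s, [/\ basis_of V s, orthonormal form s &
                {in s &, forall x y, x != y -> form (P x) (P y) = 0}].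
Proof.
have [n] := ubnP (\dim V); elim: n => // n IHn in V *.
rewrite ltnS => dV stepV.
have [V0|Vn0] := eqVneq V 0%VS.
  exists [::]; split=> //.
  by rewrite V0 basisEfree nil_free span_nil subvv dimv0.
have [x [xV x0 xh]] := stepV V (subvv V) Vn0.
pose a := (iota (seminorm id x))^-1; pose u := a *: x.
have uu : form u u = 1 by apply: (form_normalize (P := id)).
have uV : u \in V by exact: rpredZ.
have ax y : form u y = 0 -> form x y = 0.
  rewrite linearZl_LR => /eqP; rewrite mulf_eq0 => /predU1P[a0|/eqP //].
  by move: uu; rewrite /u a0 scale0r linear0l => /eqP; rewrite eq_sym oner_eq0.
pose U := (V :&: orthov form <[u]>)%VS.
have UV : (U <= V)%VS by exact: capvSl.
have dU : (\dim V).-1 = \dim U.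
  apply: eq_dim_orthov1; apply/mem_orthovPn; exists u => //.
  by rewrite /= uu oner_eq0.
have dV0 : (0 < \dim V)%N by rewrite lt0n dimv_eq0.
have uU y : y \in U -> form u y = 0.
  by rewrite memv_cap mem_orthov1 => /andP[_ /eqP/formC0].
have [||s [sU os hs]] := IHn U.
- by rewrite -dU; apply: leq_trans dV; rewrite prednK.
- by move=> U' U'U; apply: stepV; apply: subv_trans UV.
have susU y : y \in s -> y \in U by exact: (basis_mem sU).
have ous : orthonormal form (u :: s).
  rewrite orthonormal_cons uu eqxx os andbT /=.
  by apply/allP => y /susU/uU ->.
have hu y : y \in s -> form (P u) (P y) = 0.
  move=> ys; rewrite linearZ linearZl_LR /= xh ?mulr0 //.
    exact/(subvP UV)/susU.
  exact/ax/uU/susU.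
exists (u :: s); split=> //.
  apply: orthonormal_basis_of => //=.
    by move=> y; rewrite inE => /predU1P[->//|/susU/(subvP UV)].
  by rewrite (size_basis_of sU) -dU prednK.
move=> y z; rewrite !inE => /predU1P[->|ys] /predU1P[->|zs].
- by rewrite eqxx.
- by rewrite hu.
- by move=> _; apply/formC0/hu.
- exact: hs.
Qed.

(** The case [P = 0] of the diagonalization, where any nonzero vector qualifies:
plain Gram-Schmidt. *)
Lemma orthonormal_basis_exists V :
  exists2 s, basis_of V s & orthonormal form s.
Proof.
have [|s [sV os _]] := @orthobasis_diag \0%R V; last by exists s.
move=> U _ U0; exists (vpick U); rewrite memv_pick vpick0; split=> // y _ _.
exact: linear0l.
Qed.

Lemma orthonormal_extend W s : orthonormal form s -> {subset s <= W} ->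
  exists t, basis_of W (s ++ t) /\ orthonormal form (s ++ t).
Proof.
move=> os sW; pose U := (W :&: orthov form <<s>>)%VS.
have [t tU ot] := orthonormal_basis_exists U.
have st x y : x \in s -> y \in t -> form x y = 0.
  move=> xs /(basis_mem tU); rewrite memv_cap => /andP[_ /mem_orthovP yo].
  exact/formC0/yo/memv_span.
have ost : orthonormal form (s ++ t).
  have /orthonormal_kronP[us hs] := os; have /orthonormal_kronP[ut ht] := ot.
  have dis x y : x \in s -> y \in t -> (x == y) = false.
    move=> xs yt; apply/eqP => xy.
    move: (hs x x xs xs); rewrite eqxx {2}xy st //.
    by move/eqP; rewrite eq_sym oner_eq0.
  apply/orthonormal_kronP; split=> [|x y].
    rewrite cat_uniq us ut andbT /=; apply/hasPn => y yt; apply/negP => ys.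
    by move: (dis y y ys yt); rewrite eqxx.
  rewrite !mem_cat => /orP[xs|xt] /orP[ys|yt]; [exact: hs|..|exact: ht].
    by rewrite st // dis.
  by rewrite (formC0 (st _ _ ys xt)) eq_sym dis.
exists t; split=> //; rewrite basisEfree (orthonormal_free ost) /=.
have stW : (<<s ++ t>> <= W)%VS.
  apply/span_subvP => x; rewrite mem_cat => /orP[/sW//|/(basis_mem tU)].
  by rewrite memv_cap => /andP[].
rewrite stW -(eqP (orthonormal_free ost)); apply/dimvS/subvP => w wW.
rewrite span_cat -[w](subrK (orthoproj s w)) addrC.
have sUW : (<<s>> <= W)%VS by exact/span_subvP.
apply: memv_add; first exact: orthoproj_mem.
rewrite (span_basis tU) memv_cap (rpredB wW) ?(subvP sUW) ?orthoproj_mem //=.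
apply/mem_orthovP => y ys; rewrite linearBl /= form_orthoprojl //.
exact: subrr.
Qed.

(** In an orthonormal basis b of U the form [form (P _) (P _)] has a Hermitian
matrix; an eigenvector with eigenvalue a gives x such that
[form (P x) (P y) = a * form x y] on U. *)
Lemma form_diag_step (P : {linear X -> X}) U : U != 0%VS -> exists x,
  [/\ x \in U, x != 0 &
      {in U, forall y, form x y = 0 -> form (P x) (P y) = 0}].
Proof.
move=> U0; have [b bU ob] := orthonormal_basis_exists U.
pose A := \matrix_(i < size b, j < size b) form (P b`_i) (P b`_j).
have [||a /eigenvalueP[v vA v0]] := @hermitian_eigenvalue _ A.
- by rewrite (size_basis_of bU) lt0n dimv_eq0.
- by apply/matrixP => i j; rewrite !mxE form_conjC.
pose x := \sum_i v 0 i *: b`_i.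
have xb (j : 'I_(size b)) : form x b`_j = v 0 j.
  rewrite linear_sumlz (bigD1 j) //= big1 => [|i ij].
    by rewrite addr0 linearZl_LR /= orthonormal_nth // eqxx mulr1.
  by rewrite linearZl_LR /= orthonormal_nth // val_eqE (negPf ij) mulr0.
have xh y : y \in U -> form (P x) (P y) = a * form x y.
  rewrite -(span_basis bU) -[b in <<b>>%VS]in_tupleE => /coord_span ->.
  rewrite [P (\sum_(i < _) coord _ _ _ *: _)]linear_sum !linear_sumr.
  rewrite mulr_sumr; apply: eq_bigr => j _.
  rewrite linearZ !linearZr_LR /= mulrCA; congr (_ * _).
  rewrite xb.
  have := congr1 (fun w : 'rV_(size b) => w 0 j) vA; rewrite !mxE => <-.
  rewrite linear_sum linear_sumlz; apply: eq_bigr => i _.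
  by rewrite linearZ linearZl_LR mxE.
exists x; split.
- by apply: rpred_sum => i _; apply/rpredZ/(basis_mem bU)/mem_nth.
- apply: contraNneq v0 => x0; apply/eqP/rowP => i.
  by rewrite -xb x0 linear0l mxE.
- by move=> y yU xy0; rewrite xh // xy0 mulr0.
Qed.

(** * Existence of principal angles *)

Lemma orthonormal_map (g : X -> X) s : uniq s ->
  {in s &, forall x y, form (g x) (g y) = (x == y)%:R} ->
  orthonormal form (map g s).
Proof.
move=> us gs; have ginj : {in s &, injective g}.
  move=> x y xs ys gxy; apply/eqP; have := gs x y xs ys.
  by rewrite -gxy gs // eqxx; case: eqP => // _ /eqP; rewrite oner_eq0.
apply/orthonormal_kronP; split=> [|_ _ /mapP[x xs ->] /mapP[y ys ->]].
  by rewrite map_inj_in_uniq.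
by rewrite gs // (inj_in_eq ginj).
Qed.

(** Pythagoras: |x|^2 - |P x|^2 = |x - P x|^2. *)
Lemma seminorm_orthoproj_le1 s x : orthonormal form s -> form x x = 1 ->
  seminorm (orthoproj s) x <= 1.
Proof.
move=> os x1; rewrite -(@expr_le1 _ 2) ?sqrtr_ge0 // -iota_le rmorph1.
rewrite rmorphXn /= sqr_seminorm -x1 -subr_ge0.
set P := orthoproj s x; have Ps : P \in <<s>>%VS by exact: orthoproj_mem.
have xP : form x P = form P P by rewrite -(form_orthoprojl x os Ps).
have Px : form P x = form P P by rewrite -(form_orthoprojr x os Ps).
have -> : form x x - form P P = form (x - P) (x - P).
  by rewrite linearBl !linearBr /= xP Px subrr subr0.
exact: form_ge0.
Qed.

(** The singular value decomposition of the projection V -> W. Only the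
nonzero P e_i determine vectors of f, so the e_i with P e_i = 0, whose angle
pi / 2 is maximal, are put last, at the indices of the completing vectors. *)
Lemma principal_angles_exist V W : (\dim V <= \dim W)%N ->
  exists theta, is_principal_angles iota form V W theta.
Proof.
move=> dVW; have [w0 w0W ow0] := orthonormal_basis_exists W.
pose P := orthoproj w0; pose c := seminorm P; pose t x := acos (c x).
have [|e0 [e0V oe0 he0]] := @orthobasis_diag (orthoproj w0) V.
  by move=> U _; exact: form_diag_step.
have PW x : P x \in W by rewrite -(span_basis w0W) orthoproj_mem.
have PE x y : y \in W -> form y (P x) = form y x.
  by move=> yW; rewrite form_orthoprojr // (span_basis w0W).
pose e1 := sort (relpre t <=%R) [seq x <- e0 | P x != 0].
pose e2 := [seq x <- e0 | P x == 0]; pose e := e1 ++ e2.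
have ee0 : perm_eq e e0.
  rewrite perm_sym -(perm_filterC (fun x => P x != 0)) perm_sym perm_cat //.
    by rewrite perm_sort.
  rewrite (@eq_filter _ (predC _) (fun x => P x == 0)) // => x /=.
  by rewrite negbK.
have eV : basis_of V e by rewrite (perm_basis _ ee0).
have oe : orthonormal form e by rewrite (perm_orthonormal ee0).
have c_itv x : x \in e -> 0 <= c x <= 1.
  move=> xe; have /orthonormal_kronP[_ h] := oe.
  by rewrite sqrtr_ge0 seminorm_orthoproj_le1 // h // eqxx.
have tP x : x \in e -> cos (t x) = c x.
  move=> /c_itv/andP[c0 c1]; rewrite acosK // in_itv /= c1 andbT.
  by rewrite (le_trans _ c0) ?lerN10.
pose g x := (iota (c x))^-1 *: P x.
have e1E x : x \in e1 -> x \in e0 /\ P x != 0.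
  by rewrite mem_sort mem_filter => /andP[].
have of1 : orthonormal form (map g e1).
  apply: orthonormal_map => [|x y /e1E[xe Px] /e1E[ye Py]].
    by rewrite sort_uniq filter_uniq //; case/orthonormal_kronP: oe0.
  have [<-|xy] := eqVneq x y; first exact: form_normalize.
  by rewrite linearZl_LR linearZr_LR /= he0 // !mulr0.
have f1W : {subset map g e1 <= W} by move=> _ /mapP[x _ ->]; apply/rpredZ/PW.
have [f2 [fW off]] := orthonormal_extend of1 f1W.
set f := map g e1 ++ f2 in fW off.
have se := size_basis_of eV; have sf := size_basis_of fW.
(* Past the nonzero images both sides vanish, so that this one identity
   yields all the inner products. *)
have Pe i : (i < size e)%N -> P e`_i = iota (c e`_i) *: f`_i.
  rewrite /e /f !nth_cat size_cat size_map => ie.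
  case: ltnP => [i1|i1].
    have /e1E[_ Px] := mem_nth 0 i1.
    by rewrite (nth_map 0) // scalerA divff ?scale1r // fmorph_eq0 seminorm_eq0.
  have : e2`_(i - size e1) \in e2 by rewrite mem_nth // ltn_subLR.
  rewrite mem_filter -seminorm_eq0 => /andP[/eqP c0 _].
  have /eqP -> : P e2`_(i - size e1) == 0 by rewrite -seminorm_eq0 c0.
  by rewrite /c c0 rmorph0 scale0r.
exists (map t e); split.
- by rewrite size_map se (minn_idPl dVW).
- rewrite map_cat le_sorted_pairwise pairwise_cat -!le_sorted_pairwise.
  rewrite !sorted_map sort_sorted; last by move=> x y; exact: le_total.
  have t2 x : x \in e2 -> t x = pi / 2.
    rewrite mem_filter -seminorm_eq0 /t => /andP[/eqP cx _].
    by rewrite /c cx acos0.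
  apply/and3P; split=> //.
    apply/allrelP => _ _ /mapP[x xe ->] /mapP[y ye ->]; rewrite (t2 y ye).
    have xe' : x \in e by rewrite mem_cat xe.
    by case/andP: (acos_pihalf_itv (c_itv x xe')).
  rewrite -sorted_map (@eq_in_map _ _ t (fun=> pi / 2) e2).1 //.
  by elim: (e2) => //= x [|y l] //=; rewrite lexx.
- by move=> _ /mapP[x xe ->]; apply/acos_pihalf_itv/c_itv.
- exists (Tuple (introT eqP se)), (Tuple (introT eqP sf)); split=> //.
  move=> i j; rewrite /inner !(tnth_nth 0) /=.
  have ie : (i < size e)%N by rewrite se.
  have jf : (j < size f)%N by rewrite sf.
  have iF : (i < size f)%N by rewrite sf (leq_trans (ltn_ord i)).
  rewrite -PE; last by rewrite (basis_mem fW) ?mem_nth.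
  rewrite Pe // linearZr_LR /= conj_iota orthonormal_nth // eq_sym.
  rewrite (nth_map 0) // tP ?mem_nth //.
  by case: eqP; rewrite ?mulr1 ?mulr0.
Qed.

(** * Gram matrices under change of basis *)

Definition coordmx (m n : nat) (e : n.-tuple X) (x : m.-tuple X) :
    'M[K]_(m, n) :=
  \matrix_(i, j) coord e j (tnth x i).

(** The rows of [coordmx e x] are coordinates, and [inner] is conjugate-linear on
the left: hence the conjugate on the left and the transpose on the right. *)
Lemma gram_coordmx (m n p q : nat) (x : m.-tuple X) (y : n.-tuple X)
    (e : p.-tuple X) (f : q.-tuple X) :
  {subset x <= <<e>>%VS} -> {subset y <= <<f>>%VS} ->
  gram form x y =
  map_mx conj (coordmx e x) *m gram form e f *m (coordmx f y)^T.
Proof.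
move=> xe yf; apply/matrixP => i j; rewrite -mulmxA !mxE /inner.
rewrite [in LHS](coord_span (xe _ (mem_tnth i x))).
rewrite linear_sumr; apply: eq_bigr => k _; rewrite linearZr_LR /= !mxE.
congr (_ * _); rewrite [in LHS](coord_span (yf _ (mem_tnth j y))) linear_sumlz.
by apply: eq_bigr => l _; rewrite linearZl_LR !mxE /inner !(tnth_nth 0) mulrC.
Qed.

Lemma coordmx_unit (n : nat) (e v : n.-tuple X) V :
  basis_of V e -> basis_of V v -> coordmx e v \in unitmx.
Proof.
move=> eV vV; rewrite unitmxE unitfE; apply/det0P => -[u u0 uC].
case/eqP: u0; apply/rowP => i; rewrite mxE.
have /freeP fv := basis_free vV; apply: (fv (fun i => u 0 i)).
have sV : \sum_k u 0 k *: v`_k \in V.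
  apply: rpred_sum => k _; apply/rpredZ/(basis_mem vV)/mem_nth.
  by rewrite size_tuple.
rewrite (coord_basis eV sV) big1 // => j _.
have := congr1 (fun r : 'rV_n => r 0 j) uC; rewrite !mxE => uCj.
rewrite linear_sum (eq_bigr (fun k => u 0 k * coordmx e v k j)) => [|k _].
  by rewrite uCj scale0r.
by rewrite linearZ mxE (tnth_nth 0).
Qed.

Lemma gram_orthonormal (n : nat) (e : n.-tuple X) :
  orthonormal form e -> gram form e e = 1%:M.
Proof.
move=> oe; apply/matrixP => i j; rewrite !mxE /inner !(tnth_nth 0).
by rewrite orthonormal_nth ?size_tuple // eq_sym val_eqE.
Qed.

Lemma gram_conj (m n : nat) (x : m.-tuple X) (y : n.-tuple X) :
  (map_mx conj (gram form x y))^T = gram form y x.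
Proof. by apply/matrixP => i j; rewrite !mxE /inner form_conjC. Qed.

(** The quotient does not depend on the bases: the transition matrix of w
cancels against the inverse of its Gram matrix, the determinants of that of v
against det D. *)
Lemma det_gram_ratio V W (v e : (\dim V).-tuple X) (w f : (\dim W).-tuple X) :
  basis_of V v -> basis_of W w ->
  basis_of V e -> orthonormal form e -> basis_of W f -> orthonormal form f ->
  \det (gram form v w *m invmx (gram form w w) *m gram form w v)
    / \det (gram form v v)
  = \det (gram form e f *m gram form f e).
Proof.
move=> vV wW eV oe fW of_.
have ve : {subset v <= <<e>>%VS}.
  by move=> x /(basis_mem vV); rewrite (span_basis eV).
have wf : {subset w <= <<f>>%VS}.
  by move=> x /(basis_mem wW); rewrite (span_basis fW).
rewrite (gram_coordmx ve wf) (gram_coordmx wf wf) (gram_coordmx wf ve).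
rewrite (gram_coordmx ve ve) !gram_orthonormal // !mulmx1.
have := coordmx_unit eV vV; have := coordmx_unit fW wW.
set P := coordmx e v; set Q := coordmx f w => uQ uP.
have QQ : Q^T *m invmx (map_mx conj Q *m Q^T) *m map_mx conj Q = 1%:M.
  by rewrite invmx_mul ?unitmx_tr ?map_unitmx.
have -> : map_mx conj P *m gram form e f *m Q^T
    *m invmx (map_mx conj Q *m Q^T)
    *m (map_mx conj Q *m gram form f e *m P^T)
  = map_mx conj P *m (gram form e f *m gram form f e) *m P^T.
  rewrite !mulmxA; congr (_ *m _ *m _).
  by rewrite -!mulmxA [Q^T *m _]mulmxA QQ mulmx1.
rewrite !det_mulmx [X in X / _]mulrAC [LHS]mulrC mulKf // mulf_neq0 //.
  by rewrite -unitfE -unitmxE map_unitmx.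
by rewrite -unitfE -unitmxE unitmx_tr.
Qed.

(** In the bases realizing the angles the product of the two mixed Gram matrices
is diagonal, with entries the squared cosines. *)
Lemma det_principal_angles V W (theta : seq R)
    (e : (\dim V).-tuple X) (f : (\dim W).-tuple X) :
  (\dim V <= \dim W)%N -> size theta = \dim V ->
  (forall (i : 'I_(\dim V)) (j : 'I_(\dim W)),
     inner form (tnth e i) (tnth f j) =
     if i == j :> nat then iota (cos theta`_i) else 0) ->
  \det (gram form e f *m gram form f e)
  = iota ((\prod_(t <- theta) cos t) ^+ 2).
Proof.
move=> dVW st ef; pose d := \row_(i < \dim V) iota (cos theta`_i) ^+ 2.
have -> : gram form e f *m gram form f e = diag_mx d.
  apply/matrixP => i k; rewrite !mxE.
  rewrite (bigD1 (widen_ord dVW i)) //= big1 => [|j ji].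
    rewrite !mxE ef /= eqxx -[inner _ _ (tnth e k)]form_conjC [form _ _]ef /=.
    rewrite [k == i :> nat]eq_sym val_eqE addr0.
    by have [->|ik] := eqVneq i k; rewrite ?conj_iota ?rmorph0 ?mulr0.
  rewrite !mxE ef ifN ?mul0r //; apply: contraNneq ji => ij.
  exact/eqP/val_inj.
rewrite det_diag (big_nth 0) st big_mkord rmorphXn rmorph_prod -prodrXl /=.
by apply: eq_bigr => i _; rewrite mxE.
Qed.

(** * The determinant formula *)

Theorem cos_sqr_grassmann_angle V W (p q : nat)
    (v : p.-tuple X) (w : q.-tuple X) :
  basis_of V v -> basis_of W w ->
  iota (cos (grassmann_angle iota form V W) ^+ 2) =
  \det ((map_mx conj (gram form w v))^T *m invmx (gram form w w)
          *m gram form w v) / \det (gram form v v).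
Proof.
move=> vV wW; rewrite gram_conj.
have pE : p = \dim V by rewrite (size_basis vV).
have qE : q = \dim W by rewrite (size_basis wW).
subst p q; rewrite /grassmann_angle.
have narrow : (\dim W < \dim V)%N ->
    iota (cos (pi / 2) ^+ 2) = \det (gram form v w *m invmx (gram form w w)
      *m gram form w v) / \det (gram form v v).
  by move=> dWV; rewrite cos_pihalf expr0n rmorph0 det_mul_narrow // mul0r.
have [V0|V0] := eqVneq V 0%VS.
  have det1 n (M : 'M[K]_n) : n = 0 -> \det M = 1.
    by move=> n0; case: _ / (esym n0) in M *; exact: det_mx00.
  by rewrite !det1 ?V0 ?dimv0 // divr1 cos0 expr1n rmorph1.
have [W0|W0] := eqVneq W 0%VS.
  by apply: narrow; rewrite W0 dimv0 lt0n dimv_eq0.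
case: leqP => [dVW|]; last exact: narrow.
have [sz _ itv [e [f [[eV oe] [fW of_] ef]]]] :
    is_principal_angles iota form V W (principal_angles iota form V W).
  exact: (xgetPex _ (principal_angles_exist dVW)).
rewrite (det_gram_ratio vV wW eV oe fW of_).
rewrite (det_principal_angles dVW _ ef); last by rewrite sz (minn_idPl dVW).
congr (iota (_ ^+ 2)); rewrite acosK // in_itv /=.
have c_itv (t : R) : t \in principal_angles iota form V W -> 0 <= cos t <= 1.
  move=> /itv/andP[t0 t1]; rewrite cos_le1 andbT cos_ge0_pihalf // t1 andbT.
  by rewrite (le_trans _ t0) // oppr_le0 divr_ge0 ?pi_ge0.
rewrite big_seq (le_trans (lerN10 _)) ?prodr_ge0 ?prodr_ile1 //=.
  by move=> t /c_itv/andP[].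
Qed.

Theorem cos_sqr_grassmann_angle_eqdim V W (p : nat) (v w : p.-tuple X) :
  (forall a, a * conj a = `|a| ^+ 2) ->
  basis_of V v -> basis_of W w ->
  iota (cos (grassmann_angle iota form V W) ^+ 2) =
  `|\det (gram form w v)| ^+ 2 / (\det (gram form w w) * \det (gram form v v)).
Proof.
move=> normE vV wW; rewrite (cos_sqr_grassmann_angle vV wW).
rewrite !det_mulmx det_tr det_map_mx det_inv -normE invfM.
by rewrite mulrA; congr (_ * _); rewrite mulrAC; congr (_ * _); exact: mulrC.
Qed.
End InnerProductSpace.

Theorem theorem6p1 (R : realType) :
  (* real case *)
  (forall (X : vectType R) (form : {dot X for idfun}) (V W : {vspace X}),
    (forall (p q : nat) (v : p.-tuple X) (w : q.-tuple X),
       basis_of V v -> basis_of W w ->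
       let A := gram form w w in
       let B := gram form w v in
       let D := gram form v v in
       cos (grassmann_angle (@idfun R) form V W) ^+ 2
         = \det (B^T *m invmx A *m B) / \det D) /\
    (forall (p : nat) (v w : p.-tuple X),
       basis_of V v -> basis_of W w ->
       let A := gram form w w in
       let B := gram form w v in
       let D := gram form v v in
       cos (grassmann_angle (@idfun R) form V W) ^+ 2
         = `|\det B| ^+ 2 / (\det A * \det D))) /\
  (* complex case *)
  (forall (X : vectType R[i]) (form : {dot X for Num.conj}) (V W : {vspace X}),
    (forall (p q : nat) (v : p.-tuple X) (w : q.-tuple X),
       basis_of V v -> basis_of W w ->
       let A := gram form w w in
       let B := gram form w v in
       let D := gram form v v in
       (cos (grassmann_angle (real_complex R) form V W) ^+ 2)%:C
         = \det ((map_mx Num.conj B)^T *m invmx A *m B) / \det D) /\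
    (forall (p : nat) (v w : p.-tuple X),
       basis_of V v -> basis_of W w ->
       let A := gram form w w in
       let B := gram form w v in
       let D := gram form v v in
       (cos (grassmann_angle (real_complex R) form V W) ^+ 2)%:C
         = `|\det B| ^+ 2 / (\det A * \det D))).
Proof.
split=> X form V W.
  have eigR (n : nat) (A : 'M[R]_n) : (0 < n)%N -> map_mx idfun A^T = A ->
      exists a, eigenvalue A a.
    move=> n0; rewrite map_mx_id // => symA; exact: symmetric_eigenvalue.
  split=> [p q v w vV wW|p v w vV wW].
    have := @cos_sqr_grassmann_angle R R idfun idfun id (fun=> erefl)
      (fun _ _ => erefl) (fun _ _ => erefl) eigR X form V W p q v w vV wW.
    by rewrite map_mx_id.
  apply: (@cos_sqr_grassmann_angle_eqdim R R idfun idfun id (fun=> erefl)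
      (fun _ _ => erefl) (fun _ _ => erefl) eigR X form) => // x.
  by rewrite real_normK ?num_real // expr2.
have ReK (x : R[i]) : 0 <= x -> (complex.Re x)%:C = x.
  by move=> x0; apply/RRe_real/ger0_real.
have eigC (n : nat) (A : 'M[R[i]]_n) : (0 < n)%N -> map_mx Num.conj A^T = A ->
    exists a, eigenvalue A a by move=> n0 _; exact: eigenvalue_closed.
split=> [p q v w vV wW|p v w vV wW].
  exact: (@cos_sqr_grassmann_angle R R[i] Num.conj (real_complex R)
    (@complex.Re R) (@conjc_real R) (@lecR R) ReK eigC).
apply: (@cos_sqr_grassmann_angle_eqdim R R[i] Num.conj (real_complex R)
    (@complex.Re R) (@conjc_real R) (@lecR R) ReK eigC) => // x.
by rewrite normCK.
Qed.
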